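(* Let $c>0$, $\sigma>0$, and let $\alpha_l(y)=\sigma y$ on $(0,c]$. (i) If $\alpha_{vex}\in\mathcal{K}_{vex}$ (strictly convex) and $\alpha_{vex}(c)\le\alpha_l(c)$, then for every $\epsilon\in(0,c)$, $\sigma_{\alpha_{vex}}(\epsilon,c)<\sigma$. (ii) Suppose $\alpha_{cave}\in\mathcal{K}_{cave}$ (strictly concave) with $\alpha_{cave}(c)<\alpha_l(c)$, and suppose there exists $y^\star\in(0,c)$ such that $\alpha_{cave}(y^\star)>\alpha_l(y^\star)$. Then there exist $c_0\in(y^\star,c)$ and $\epsilon_0\in(0,c_0)$ such that for all $\epsilon\in(0,\epsilon_0)$, $\sigma_{\alpha_{cave}}(\epsilon,c)>\sigma$.
   Context: A function $\alpha:[0,a)\to[0,\infty)$ (with $0<a\le\infty$) is of class $\mathcal{K}$ if it is continuous, strictly increasing on $[0,a)$ and $\alpha(0)=0$. $\mathcal{K}_{cave}$ and $\mathcal{K}_{vex}$ denote the class-$\mathcal{K}$ functions that are strictly concave, respectively strictly convex. All comparison functions here have domain containing $[0,c]$. For $\alpha\in\mathcal{K}$ and $0<\epsilon<c$, the crossing time is $T_\alpha(\epsilon,c)=\int_\epsilon^c \frac{1}{\alpha(y)}\,dy$ and the windowed nominal rate is $\sigma_\alpha(\epsilon,c)=\frac{\ln(c/\epsilon)}{T_\alpha(\epsilon,c)}$. *)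

(* Defs.v *)
From Stdlib Require Import Reals.
From Coquelicot Require Import Coquelicot.
Open Scope R_scope.

(** Partial functions on [[0, a)], [0 < a <= +oo], are represented by total
    functions [R -> R] whose values outside [[0, a)] are unconstrained. *)

Definition Ico0 (a : Rbar) (y : R) : Prop := 0 <= y /\ Rbar_lt y a.

(** [continuous_on] is continuity relative to the domain, hence one-sided
    at [0]. *)
Definition class_K (a : Rbar) (alpha : R -> R) : Prop :=
  Rbar_lt 0 a /\
  (forall y, Ico0 a y -> 0 <= alpha y) /\
  continuous_on (Ico0 a) alpha /\
  (forall x y, Ico0 a x -> Ico0 a y -> x < y -> alpha x < alpha y) /\
  alpha 0 = 0.

Definition strictly_concave_on (D : R -> Prop) (f : R -> R) : Prop :=
  forall x y t, D x -> D y -> x <> y -> 0 < t < 1 ->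
    t * f x + (1 - t) * f y < f (t * x + (1 - t) * y).

Definition strictly_convex_on (D : R -> Prop) (f : R -> R) : Prop :=
  forall x y t, D x -> D y -> x <> y -> 0 < t < 1 ->
    f (t * x + (1 - t) * y) < t * f x + (1 - t) * f y.

Definition class_K_cave (a : Rbar) (alpha : R -> R) : Prop :=
  class_K a alpha /\ strictly_concave_on (Ico0 a) alpha.

Definition class_K_vex (a : Rbar) (alpha : R -> R) : Prop :=
  class_K a alpha /\ strictly_convex_on (Ico0 a) alpha.

(** Meaningful for [class_K a alpha] and [0 < eps < c < a]: then [alpha] is
    continuous and positive on [[eps, c]], so the Riemann integral exists and
    is positive. *)
Definition crossing_time (alpha : R -> R) (eps c : R) : R :=
  RInt (fun y => 1 / alpha y) eps c.

Definition nominal_rate (alpha : R -> R) (eps c : R) : R :=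
  ln (c / eps) / crossing_time alpha eps c.

(* Main.v *)
Require Import Defs.
From Stdlib Require Import Reals Lra.
From Coquelicot Require Import Coquelicot.
Open Scope R_scope.

(** A class-K function [alpha] is compared with its chord through the origin,
    since the crossing time of a linear rate is explicit: the integral of
    [1 / (k y)] over [[u, v]] is [ln (v / u) / k].

    Convex case.  A strictly convex function vanishing at [0] lies strictly
    below its chord from [(0, 0)] to [(c, alpha c)], which lies below
    [sigma y].  Hence [1 / alpha y > 1 / (sigma y)] on [(0, c)], and
    integrating (the integrands are continuous, so strictness survives) shows
    that the crossing time exceeds [ln (c / eps) / sigma]
    ([crossing_time_convex_gt]).

    Concave case.  The chord through [ystar] has slope
    [k = alpha ystar / ystar > sigma], and [alpha] lies above it on
    [(0, ystar]].  So the time spent on [[eps, ystar]] is at most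
    [ln (ystar / eps) / k], whereas the time spent on [[ystar, c]] is at most a
    constant [M] that does not depend on [eps]
    ([crossing_time_concave_le]).  A linear rate [sigma] needs
    [ln (c / eps) / sigma > ln (ystar / eps) / sigma], and the gain
    [ln (ystar / eps) * (1 / sigma - 1 / k)] exceeds [M] once [eps] is small:
    the logarithmic divergence at [0] outweighs any finite loss above
    [ystar] ([ln_ratio_gt_near_0]). *)

(** * Class-K functions away from the origin *)

Lemma Ico0_le (a : Rbar) (c y : R) :
  Rbar_lt c a -> 0 <= y <= c -> Ico0 a y.
Proof.
  intros Hca Hy; split; [lra|].
  apply Rbar_le_lt_trans with (y := Finite c); [simpl; lra | exact Hca].
Qed.

Lemma class_K_pos (a : Rbar) (alpha : R -> R) (y : R) :
  class_K a alpha -> 0 < y -> Rbar_lt y a -> 0 < alpha y.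
Proof.
  intros (Ha & _ & _ & Hincr & H0) Hy Hya.
  rewrite <- H0; apply Hincr; [| |exact Hy]; split; try lra; assumption.
Qed.

(** Every [y > 0] of the domain is interior to it, so the relative continuity
    in [class_K] becomes two-sided there. *)
Lemma class_K_continuous_inv (a : Rbar) (alpha : R -> R) (y : R) :
  class_K a alpha -> 0 < y -> Rbar_lt y a ->
  continuous (fun z => 1 / alpha z) y.
Proof.
  intros HK Hy Hya.
  pose proof (class_K_pos a alpha y HK Hy Hya) as Hpos.
  destruct HK as (_ & _ & Hcont & _).
  apply continuous_ext with (f := fun z => / alpha z).
  { intros z; symmetry; apply Rdiv_1_l. }
  apply continuous_Rinv_comp; [|lra].
  apply continuous_continuous_on with (D := Ico0 a); [|exact Hcont].
  apply filter_and.
  - generalize (open_Rbar_gt' y 0 Hy).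
    apply filter_imp; intros z Hz; simpl in Hz; lra.
  - exact (open_Rbar_lt' y a Hya).
Qed.

Lemma class_K_ex_RInt_inv (a : Rbar) (alpha : R -> R) (u v : R) :
  class_K a alpha -> 0 < u <= v -> Rbar_lt v a ->
  ex_RInt (fun y => 1 / alpha y) u v.
Proof.
  intros HK Huv Hva.
  apply (ex_RInt_continuous (V := R_CompleteNormedModule)).
  intros z; rewrite Rmin_left, Rmax_right by lra; intros Hz.
  apply class_K_continuous_inv with a; [exact HK | lra |].
  apply (Ico0_le a v z Hva); lra.
Qed.

Lemma crossing_time_pos (a : Rbar) (alpha : R -> R) (eps c : R) :
  class_K a alpha -> 0 < eps < c -> Rbar_lt c a ->
  0 < crossing_time alpha eps c.
Proof.
  intros HK He Hca.
  assert (Hdom : forall y, eps <= y <= c -> Rbar_lt y a).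
  { intros y Hy; apply (Ico0_le a c y Hca); lra. }
  apply RInt_gt_0; [lra | |].
  - intros y Hy; apply Rdiv_lt_0_compat; [lra|].
    apply class_K_pos with a; [exact HK | lra | apply Hdom; lra].
  - intros y Hy.
    apply class_K_continuous_inv with a; [exact HK | lra | apply Hdom; lra].
Qed.

(** * Linear rates *)

Lemma continuous_inv_linear (k y : R) :
  0 < k -> 0 < y -> continuous (fun z => 1 / (k * z)) y.
Proof.
  intros Hk Hy.
  assert (k * y <> 0) by (apply Rgt_not_eq, Rmult_lt_0_compat; lra).
  apply (ex_derive_continuous (V := R_NormedModule)).
  auto_derive; assumption.
Qed.

Lemma is_RInt_inv_linear (k u v : R) :
  0 < k -> 0 < u <= v ->
  is_RInt (fun y => 1 / (k * y)) u v (ln (v / u) / k).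
Proof.
  intros Hk Huv.
  replace (ln (v / u) / k) with (minus (ln v / k) (ln u / k)).
  2: { rewrite ln_div by lra; unfold minus, plus, opp; simpl; field; lra. }
  apply (is_RInt_derive (V := R_CompleteNormedModule) (fun y => ln y / k));
    intros y; rewrite Rmin_left, Rmax_right by lra; intros Hy.
  - auto_derive; [lra | field; lra].
  - apply continuous_inv_linear; lra.
Qed.

(** * Position with respect to a chord through the origin *)

Lemma strictly_convex_below_chord (D : R -> Prop) (f : R -> R) (c y : R) :
  strictly_convex_on D f -> D 0 -> D c -> f 0 = 0 -> 0 < y < c ->
  f y < y / c * f c.
Proof.
  intros Hf D0 Dc H0 Hy.
  assert (Ht : 0 < y / c < 1).
  { split; [apply Rdiv_lt_0_compat; lra | apply Rlt_div_l; lra]. }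
  assert (Hne : c <> 0) by lra.
  generalize (Hf c 0 (y / c) Dc D0 Hne Ht).
  replace (y / c * c + (1 - y / c) * 0) with y by (field; lra).
  rewrite H0; lra.
Qed.

Lemma strictly_concave_above_chord (D : R -> Prop) (f : R -> R) (c y : R) :
  strictly_concave_on D f -> D 0 -> D c -> f 0 = 0 -> 0 < y < c ->
  y / c * f c < f y.
Proof.
  intros Hf D0 Dc H0 Hy.
  assert (Ht : 0 < y / c < 1).
  { split; [apply Rdiv_lt_0_compat; lra | apply Rlt_div_l; lra]. }
  assert (Hne : c <> 0) by lra.
  generalize (Hf c 0 (y / c) Dc D0 Hne Ht).
  replace (y / c * c + (1 - y / c) * 0) with y by (field; lra).
  rewrite H0; lra.
Qed.

(** * Bounds on the crossing time *)

Lemma crossing_time_convex_gt (a : Rbar) (alpha : R -> R) (sigma eps c : R) :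
  class_K_vex a alpha -> Rbar_lt c a -> 0 < sigma -> 0 < eps < c ->
  alpha c <= sigma * c ->
  ln (c / eps) / sigma < crossing_time alpha eps c.
Proof.
  intros [HK Hvex] Hca Hs He Hc.
  assert (Hdom : forall y, 0 <= y <= c -> Ico0 a y).
  { intros y Hy; apply (Ico0_le a c y Hca Hy). }
  rewrite <- (is_RInt_unique _ _ _ _
                (is_RInt_inv_linear sigma eps c Hs ltac:(lra))).
  apply RInt_lt; [lra | | |]; intros y Hy.
  - apply class_K_continuous_inv with a; [exact HK | lra | apply Hdom; lra].
  - apply continuous_inv_linear; lra.
  - assert (Hpos : 0 < alpha y).
    { apply class_K_pos with a; [exact HK | lra | apply Hdom; lra]. }
    assert (Hchord : alpha y < y / c * alpha c).
    { apply strictly_convex_below_chord with (Ico0 a);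
        [exact Hvex | apply Hdom; lra | apply Hdom; lra | apply HK | lra]. }
    assert (Hslope : y / c * alpha c <= sigma * y).
    { replace (sigma * y) with (y / c * (sigma * c)) by (field; lra).
      apply Rmult_le_compat_l; [|exact Hc].
      apply Rlt_le, Rdiv_lt_0_compat; lra. }
    unfold Rdiv; apply Rmult_lt_compat_l; [lra|].
    apply Rinv_lt_contravar; [|lra].
    apply Rmult_lt_0_compat; lra.
Qed.

(** The split at [ystar] isolates the part that depends on [eps]: below
    [ystar] concavity gives the chord bound, above it monotonicity alone gives
    [1 / alpha <= 1 / alpha ystar]. *)
Lemma crossing_time_concave_le (a : Rbar) (alpha : R -> R) (ystar eps c : R) :
  class_K_cave a alpha -> Rbar_lt c a -> 0 < eps < ystar -> ystar < c ->
  crossing_time alpha eps c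
  <= ln (ystar / eps) / (alpha ystar / ystar) + (c - ystar) / alpha ystar.
Proof.
  intros [HK Hcave] Hca He Hys.
  assert (Hdom : forall y, 0 <= y <= c -> Ico0 a y).
  { intros y Hy; apply (Ico0_le a c y Hca Hy). }
  assert (Hpos : 0 < alpha ystar).
  { apply class_K_pos with a; [exact HK | lra | apply Hdom; lra]. }
  assert (Hk : 0 < alpha ystar / ystar) by (apply Rdiv_lt_0_compat; lra).
  assert (Hex1 : ex_RInt (fun y => 1 / alpha y) eps ystar).
  { apply class_K_ex_RInt_inv with a; [exact HK | lra | apply Hdom; lra]. }
  assert (Hex2 : ex_RInt (fun y => 1 / alpha y) ystar c).
  { apply class_K_ex_RInt_inv with a; [exact HK | lra | exact Hca]. }
  unfold crossing_time.
  rewrite <- (RInt_Chasles (V := R_CompleteNormedModule) _ _ _ _ Hex1 Hex2).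
  apply Rplus_le_compat.
  - pose proof (is_RInt_inv_linear _ eps ystar Hk ltac:(lra)) as Hlin.
    rewrite <- (is_RInt_unique _ _ _ _ Hlin).
    apply RInt_le; [lra | exact Hex1 | eexists; exact Hlin |].
    intros y Hy.
    assert (Hchord : y / ystar * alpha ystar < alpha y).
    { apply strictly_concave_above_chord with (Ico0 a);
        [exact Hcave | apply Hdom; lra | apply Hdom; lra | apply HK | lra]. }
    unfold Rdiv at 1 2; apply Rmult_le_compat_l; [lra|].
    apply Rinv_le_contravar; [apply Rmult_lt_0_compat; lra|].
    replace (alpha ystar / ystar * y) with (y / ystar * alpha ystar)
      by (field; lra).
    lra.
  - replace ((c - ystar) / alpha ystar)
      with (RInt (fun _ => / alpha ystar) ystar c)
      by (rewrite RInt_const; reflexivity).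
    apply RInt_le; [lra | exact Hex2 | apply ex_RInt_const |].
    intros y Hy.
    assert (alpha ystar < alpha y).
    { apply HK; [apply Hdom; lra | apply Hdom; lra | lra]. }
    unfold Rdiv; rewrite Rmult_1_l; apply Rinv_le_contravar; lra.
Qed.

(** * Comparison with the linear rate *)

(** Logarithmic divergence at [0] beats any constant [M]; the threshold solves
    [ln (y / eps) * d = M]. *)
Lemma ln_ratio_gt_near_0 (y d M eps : R) :
  0 < y -> 0 < d -> 0 < eps < y * exp (- (M / d)) ->
  M < ln (y / eps) * d.
Proof.
  intros Hy Hd He.
  assert (Hln : ln eps < ln y - M / d).
  { replace (ln y - M / d) with (ln (y * exp (- (M / d)))).
    - apply ln_increasing; lra.
    - rewrite ln_mult by (lra || apply exp_pos); rewrite ln_exp; lra. }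
  rewrite ln_div by lra.
  replace M with (M / d * d) at 1 by (field; lra).
  apply Rmult_lt_compat_r; lra.
Qed.

Theorem theorem1 (c sigma : R) (Hc : 0 < c) (Hsigma : 0 < sigma)
    (alpha_l : R -> R)
    (Halpha_l : forall y : R, 0 < y <= c -> alpha_l y = sigma * y) :
  (forall (a : Rbar) (alpha_vex : R -> R),
      Rbar_lt c a ->
      class_K_vex a alpha_vex ->
      alpha_vex c <= alpha_l c ->
      forall eps : R, 0 < eps < c ->
        nominal_rate alpha_vex eps c < sigma)
  /\
  (forall (a : Rbar) (alpha_cave : R -> R),
      Rbar_lt c a ->
      class_K_cave a alpha_cave ->
      alpha_cave c < alpha_l c ->
      forall ystar : R, 0 < ystar < c ->
      alpha_cave ystar > alpha_l ystar ->
      exists c0 : R, ystar < c0 < c /\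
        exists eps0 : R, 0 < eps0 < c0 /\
          forall eps : R, 0 < eps < eps0 ->
            nominal_rate alpha_cave eps c > sigma).
Proof.
  split.
  - intros a alpha Hca Hvex Hle eps He.
    rewrite Halpha_l in Hle by lra.
    pose proof (crossing_time_convex_gt a alpha sigma eps c
                  Hvex Hca Hsigma He Hle) as HT.
    pose proof (crossing_time_pos a alpha eps c (proj1 Hvex) He Hca) as HTpos.
    apply Rlt_div_l; [exact HTpos|].
    rewrite Rmult_comm; apply Rlt_div_l; [exact Hsigma | exact HT].
  - intros a alpha Hca Hcave _ ystar Hys Hgt.
    rewrite Halpha_l in Hgt by lra.
    set (k := alpha ystar / ystar).
    assert (Hk : sigma < k) by (apply Rlt_div_r; lra).
    set (d := 1 / sigma - 1 / k).
    assert (Hd : 0 < d).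
    { assert (/ k < / sigma)
        by (apply Rinv_lt_contravar; [apply Rmult_lt_0_compat|]; lra).
      unfold d, Rdiv; lra. }
    assert (Hpos : 0 < alpha ystar).
    { apply Rlt_trans with (sigma * ystar); [|lra].
      apply Rmult_lt_0_compat; lra. }
    set (M := (c - ystar) / alpha ystar).
    assert (HM : 0 < M) by (apply Rdiv_lt_0_compat; lra).
    set (eps0 := ystar * exp (- (M / d))).
    assert (Heps0 : 0 < eps0 < ystar).
    { assert (0 < M / d) by (apply Rdiv_lt_0_compat; lra).
      assert (exp (- (M / d)) < 1)
        by (rewrite <- exp_0; apply exp_increasing; lra).
      pose proof (exp_pos (- (M / d))).
      unfold eps0; split; [apply Rmult_lt_0_compat; lra|].
      rewrite <- (Rmult_1_r ystar) at 2; apply Rmult_lt_compat_l; lra. }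
    (* The threshold lies below [ystar] already, so any point of
       [(ystar, c)] can serve as [c0]. *)
    exists ((ystar + c) / 2); split; [lra|].
    exists eps0; split; [lra|].
    intros eps He.
    pose proof (crossing_time_concave_le a alpha ystar eps c
                  Hcave Hca ltac:(lra) ltac:(lra)) as HT.
    fold k M in HT.
    pose proof (ln_ratio_gt_near_0 ystar d M eps
                  ltac:(lra) Hd He) as Hgain.
    assert (Hln : ln (ystar / eps) < ln (c / eps)).
    { rewrite !ln_div by lra.
      assert (ln ystar < ln c) by (apply ln_increasing; lra); lra. }
    pose proof (crossing_time_pos a alpha eps c (proj1 Hcave)
                  ltac:(lra) Hca) as HTpos.
    apply Rlt_div_r; [exact HTpos|].
    rewrite Rmult_comm; apply Rlt_div_r; [exact Hsigma|].
    apply Rlt_trans with (ln (ystar / eps) / sigma).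
    + apply Rle_lt_trans with (1 := HT).
      replace (ln (ystar / eps) / sigma)
        with (ln (ystar / eps) / k + ln (ystar / eps) * d)
        by (unfold d; field; lra).
      lra.
    + apply Rmult_lt_compat_r; [apply Rinv_0_lt_compat|]; lra.
Qed.
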